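(* Let $H$ be a hypergraph in which every pair of distinct hyperedges intersects in at most $\overline{\lambda}$ vertices. For a positive integer $t$, let $\overline{D}_t$ be the minimum, over all choices of $t$ distinct hyperedges of $H$, of the sum of their cardinalities. Then for every integer $t$ with $1\le t\le m(H)$, $$b_L(H)\ge \overline{D}_t-\overline{\lambda}\binom{t}{2}-t.$$
   Context: A hypergraph $H$ consists of a finite vertex set $V(H)$ and a finite collection $E(H)$ of subsets of $V(H)$. Lazy burning: a set $B\subseteq V(H)$ is burned initially; in each subsequent round every unburned vertex $v$ for which some hyperedge $h\ni v$ has $h\setminus\{v\}$ entirely burned becomes burned. $B$ is a lazy burning set if eventually all vertices burn; $b_L(H)$ is the minimum size of a lazy burning set. The incidence graph $\mathrm{IG}(H)$ is the bipartite graph on $V(H)\cup E(H)$ with $v\sim h$ iff $v\in h$. A $C$-matching is a list $(v_1h_1,\dots,v_kh_k)$ of edges of $\mathrm{IG}(H)$ with $v_i\in h_i$ and $h_i\cap\{v_{i+1},\dots,v_k\}=\emptyset$ for all $i$; $m(H)$ is the maximum length of a $C$-matching. *)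

(* Defs.v *)
From mathcomp Require Import all_boot.

Set Implicit Arguments.
Unset Strict Implicit.
Unset Printing Implicit Defensive.

(* A hypergraph is a finite vertex type [V] with a set [E] of subsets of [V]. *)

Section LazyBurning.

Variables (V : finType) (E : {set {set V}}).

Definition burn_step (B : {set V}) : {set V} :=
  B :|: [set v | [exists h in E, (v \in h) && (h :\ v \subset B)]].

Definition burned (B : {set V}) (r : nat) : {set V} := iter r burn_step B.

(* The bound on the number of rounds only serves to keep the predicate        *)
(* boolean; lazy_burning_setP removes it.                                     *)
Definition lazy_burning_set (B : {set V}) : bool :=
  [exists r : 'I_#|V|.+1, burned B r == setT].

Lemma lazy_burning_setP (B : {set V}) :
  reflect (exists r, burned B r = setT) (lazy_burning_set B).
Proof.
apply: (iffP existsP) => [[r /eqP Br] | [r0 Br0]]; first by exists r.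
have exr : exists r, burned B r == setT by exists r0; apply/eqP.
case: (ex_minnP exr) => r Br minr.
suff grow i : i <= r -> i <= #|burned B i|.
  have le_rV : r < #|V|.+1 by rewrite ltnS (leq_trans (grow r _)) ?max_card.
  by exists (Ordinal le_rV).
elim: i => // i IHi lt_ir; apply: leq_ltn_trans (IHi (ltnW lt_ir)) _.
apply: proper_card; rewrite properEneq subsetUl andbT.
apply/eqP => fixi.
have stab j : burned B (j + i) = burned B i.
  elim: j => // j IHj.
  by rewrite [LHS](_ : _ = burn_step (burned B (j + i))) // IHj [RHS]fixi.
suff /minr : burned B i == setT by rewrite leqNgt lt_ir.
by rewrite -(stab (r - i)) subnK // ltnW.
Qed.

(* [setT] is a lazy burning set of size #|V|, so the default value #|V| never *)
(* affects the minimum.                                                       *)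
Definition b_L : nat := \big[minn/#|V|]_(B : {set V} | lazy_burning_set B) #|B|.

Definition IG_edge (p : V * {set V}) : bool := (p.2 \in E) && (p.1 \in p.2).

Definition C_matching (s : seq (V * {set V})) : bool :=
  all IG_edge s &&
  pairwise (fun p q : V * {set V} => q.1 \notin p.2) s.

Lemma C_matching_size s : C_matching s -> size s <= #|V|.
Proof.
case/andP=> IGs Cs; rewrite -(size_map fst) -(card_uniqP _) ?max_card //.
elim: s IGs Cs => //= p s IHs /andP[/andP[_ ph] IGs] /andP[Cp Cs].
rewrite IHs // andbT; apply/mapP => -[q sq eq_pq].
by have /allP/(_ q sq) := Cp; rewrite -eq_pq ph.
Qed.

(* By C_matching_size, bounding the length by #|V| excludes no C-matching.    *)
Definition m_H : nat :=
  \max_(k < #|V|.+1 | [exists s : k.-tuple (V * {set V}), C_matching s]) k.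

(* The default value, the sum of all the hyperedge sizes, is at least the sum *)
(* over any [S \subset E], so it affects the minimum only if [E] has fewer    *)
(* than [t] members.                                                          *)
Definition D_min (t : nat) : nat :=
  \big[minn / \sum_(h in E) #|h|]_(S : {set {set V}} | (S \subset E) && (#|S| == t))
    \sum_(h in S) #|h|.

End LazyBurning.

(* Main.v *)
Require Import Defs.
From mathcomp Require Import all_boot all_order all_algebra.

Import Order.TTheory GRing.Theory Num.Theory.
Local Open Scope ring_scope.

(** A C-matching of length k burns the complement of its vertices, one matched
    vertex per round, so t <= m(H) forces b_L(H) <= |V| - t. Hence, starting from
    a minimum lazy burning set B, the fire still spreads to t further vertices;
    burning them one at a time uses t distinct hyperedges, all contained in B
    together with these t vertices. Their union thus has at most b_L(H) + t
    elements, and by Bonferroni's inequality at least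
    D_t - lambda * binomial(t, 2). *)

Lemma bigminn_le_cond {I : finType} {P : pred I} (F : I -> nat) (x : nat) {i : I} :
  P i -> (\big[minn/x]_(j | P j) F j <= F i)%N.
Proof. by move=> Pi; rewrite -minEnat -leEnat; apply: bigmin_le_cond. Qed.

(** The default [F i] is itself a value of [F] on [P], so the minimum is attained whichever term
    supplies it. *)
Lemma bigminn_attained {I : finType} {P : pred I} (F : I -> nat) {i : I} :
  P i -> exists2 j, P j & \big[minn/F i]_(j | P j) F j = F j.
Proof.
move=> Pi; apply: (big_ind (fun n => exists2 j, P j & n = F j)).
- by exists i.
- by move=> m n [j Pj ->] [k Pk ->]; case: leqP; [exists j | exists k].
- by move=> j Pj; exists j.
Qed.

(** Induction on the number of hyperedges: a hyperedge [h] meets the union of the [n] others in at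
    most [lam * n] vertices, and ['C(n.+1, 2) = 'C(n, 2) + n]. *)
Lemma sum_card_le_cover {V : finType} {S : {set {set V}}} {lam : nat} :
    {in S &, forall h h', h != h' -> (#|h :&: h'| <= lam)%N} ->
  (\sum_(h in S) #|h| <= #|cover S| + lam * 'C(#|S|, 2))%N.
Proof.
elim: {S}#|S| {-2}S (erefl #|S|) => [|n IHn] S cS lamS.
  by rewrite (cards0_eq cS) big_set0.
have [h hS] : exists h, h \in S by apply/card_gt0P; rewrite cS.
have cSh : #|S :\ h| = n by apply/eqP; rewrite -eqSS -cS (cardsD1 h S) hS.
have lamSh : {in S :\ h &, forall k k', k != k' -> (#|k :&: k'| <= lam)%N}.
  by move=> k k' /setD1P[_ kS] /setD1P[_ k'S]; apply: lamS.
have coverS : cover S = h :|: cover (S :\ h).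
  by rewrite /cover (big_setD1 h hS).
have meet : (#|h :&: cover (S :\ h)| <= lam * n)%N.
  rewrite mulnC -cSh -sum_nat_const /cover.
  elim/big_rec2: _ => [|k m A /setD1P[kh kS] IH]; first by rewrite setI0 cards0.
  rewrite setIUr (leq_trans (leq_card_setU _ _)) // leq_add //.
  by rewrite lamS // eq_sym.
rewrite cS binS bin1 mulnDr (big_setD1 h hS) /= coverS.
have := IHn _ cSh lamSh; rewrite cSh => IH.
apply: leq_trans (leq_add (leqnn #|h|) IH) _.
(* Inclusion-exclusion for the two sets [h] and [cover (S :\ h)]; [meet] bounds their
   intersection. *)
by rewrite addnA -cardsUI -addnA leq_add2l addnC leq_add2l.
Qed.

Section Burning.

Set Implicit Arguments.
Unset Strict Implicit.

Variables (V : finType) (E : {set {set V}}).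

Implicit Types (A B : {set V}).

Lemma lazy_burning_setT : lazy_burning_set E setT.
Proof. by apply/lazy_burning_setP; exists 0%N. Qed.

Lemma b_L_le B : lazy_burning_set E B -> (b_L E <= #|B|)%N.
Proof. exact: bigminn_le_cond. Qed.

Lemma b_L_attained : exists2 B, lazy_burning_set E B & #|B| = b_L E.
Proof.
(* The default [#|V|] of [b_L] is the size of [setT], a lazy burning set. *)
have [B lB eB] := bigminn_attained (fun B => #|B|) lazy_burning_setT.
by exists B => //; rewrite -eB cardsT.
Qed.

(** For a head [(v, h)], the set [h :\ v] avoids all vertices of the list, so it is burned after [r]
    rounds and [v] burns in the next one. Keeping [r] general lets the induction pass to the tail
    with [r.+1]. *)
Lemma C_matching_burned B s r :
    C_matching E s -> ~: [set v in map fst s] \subset burned E B r ->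
  burned E B (size s + r) = setT.
Proof.
elim: s r => [|[v h] s IHs] r.
  move=> _ sub; apply/eqP; rewrite eqEsubset subsetT /=.
  by apply: subset_trans sub; apply/subsetP => u _; rewrite !inE.
case/andP=> /= /andP[/andP[/= hE vh] IGs] /andP[/allP Ch Cs] /subsetP sub.
rewrite -[LHS]/(burned E B ((size s).+1 + r)) addSnnS; apply: IHs; first exact/andP.
apply/subsetP => u; rewrite inE [u \in _]inE => us.
rewrite /burned /= -/(burned E B r) /burn_step in_setU.
have [-> | uv] := eqVneq u v; last first.
  by rewrite sub // inE [u \in _]inE in_cons negb_or uv.
apply/orP; right; rewrite inE; apply/existsP; exists h.
rewrite hE vh /=; apply/subsetP => w; rewrite in_setD1 => /andP[wv wh].
apply: sub; rewrite inE [w \in _]inE in_cons negb_or wv /=.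
apply/mapP => -[p ps wp]; by have := Ch p ps; rewrite /= -wp wh.
Qed.

Lemma C_matching_lazy s :
  C_matching E s -> lazy_burning_set E (~: [set v in map fst s]).
Proof.
by move=> Cs; apply/lazy_burning_setP; exists (size s + 0)%N;
  apply: C_matching_burned.
Qed.

Lemma C_matching_uniq s : C_matching E s -> uniq (map fst s).
Proof.
elim: s => //= -[v h] s IHs /andP[/= /andP[/andP[/= hE vh] IGs]].
case/andP=> /allP Ch Cs; rewrite IHs ?andbT; last exact/andP.
by apply/mapP => -[p ps vp]; have := Ch p ps; rewrite /= -vp vh.
Qed.

Lemma b_L_m_H : (b_L E + m_H E <= #|V|)%N.
Proof.
(* This makes the truncated difference [#|V| - b_L E] exact, so that the maximum [m_H] can be
   bounded one matching at a time. *)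
have le_bV : (b_L E <= #|V|)%N by rewrite -cardsT b_L_le ?lazy_burning_setT.
rewrite -leq_subRL //; apply/bigmax_leqP => k /existsP[s Cs].
have cs : #|[set v in map fst s]| = k.
  by rewrite cardsE (card_uniqP (C_matching_uniq Cs)) size_map size_tuple.
have := cardsC [set v in map fst s]; rewrite cs leq_subRL // => eV.
by rewrite -[leqRHS]eV addnC leq_add2l b_L_le ?C_matching_lazy.
Qed.

(** If no hyperedge had exactly one vertex outside [A], then [A] would be closed under burning and
    contain every round started from [B], hence all of [V]. *)
Lemma lazy_burning_spread B A :
    lazy_burning_set E B -> B \subset A -> A != setT ->
  exists2 h, h \in E & exists2 v, v \in h :\: A & h :\ v \subset A.
Proof.
case/lazy_burning_setP=> r Br sBA AT.
have [/existsP[h /andP[hE /existsP[v /andP[vhA sub]]]]|stuck] :=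
  boolP [exists h in E, exists v, (v \in h :\: A) && (h :\ v \subset A)].
  by exists h => //; exists v.
case/eqP: AT; apply/eqP; rewrite eqEsubset subsetT -Br.
elim: r {Br} => [//|r IHr]; apply/subsetP => v.
rewrite /burned /= -/(burned E B r) /burn_step in_setU.
case/orP=> [/(subsetP IHr)//|]; rewrite inE => /existsP[h /and3P[hE vh sub]].
apply: contraNT stuck => vA; apply/existsP; exists h; rewrite hE /=.
by apply/existsP; exists v; rewrite inE vA vh (subset_trans sub).
Qed.

(** Each step adds one vertex [v] to [A] and one hyperedge [h] containing [v] to [S]. The earlier
    hyperedges lie inside the old [A], which misses [v], so [h] is new. *)
Lemma lazy_burning_edges B t :
    lazy_burning_set E B -> (#|B| + t <= #|V|)%N ->
  exists2 S : {set {set V}}, (S \subset E) && (#|S| == t)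
    & exists A, [/\ B \subset A, cover S \subset A & #|A| = (#|B| + t)%N].
Proof.
move=> lB; elim: t => [|t IHt] le_tV.
  exists set0; first by rewrite sub0set cards0.
  by exists B; rewrite /cover big_set0 sub0set addn0.
rewrite addnS in le_tV *.
have [S /andP[sSE /eqP cS] [A [sBA sSA cA]]] := IHt (ltnW le_tV).
(* The size bound leaves an unburned vertex as long as fewer than [t] have been added. *)
have AT : A != setT by apply: contraTneq le_tV => AT; rewrite -cA AT cardsT ltnn.
have [h hE [v /setDP[vh vA] hvA]] := lazy_burning_spread lB sBA AT.
have hS : h \notin S.
  by apply: contra vA => hS; apply: (subsetP sSA); apply/bigcupP; exists h.
exists (h |: S); first by rewrite subUset sub1set hE sSE cardsU1 hS cS eqxx.
exists (v |: A); split; last by rewrite cardsU1 vA cA.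
  exact: subset_trans (subsetUr _ _).
rewrite /cover bigcup_setU big_set1 subUset -subDset hvA.
by rewrite (subset_trans sSA) ?subsetUr.
Qed.

End Burning.

Theorem theorem2p7 (V : finType) (E : {set {set V}}) (lam : nat)
    (hlam : forall h h' : {set V},
      h \in E -> h' \in E -> h != h' -> (#|h :&: h'| <= lam)%N)
    (t : nat) (ht1 : (1 <= t)%N) (htm : (t <= m_H E)%N) :
  (D_min E t)%:Z - lam%:Z * ('C(t, 2))%:Z - t%:Z <= (b_L E)%:Z.
Proof.
have [B lB cB] := b_L_attained E.
have le_tV : (#|B| + t <= #|V|)%N.
  by rewrite cB (leq_trans _ (b_L_m_H E)) ?leq_add2l.
have [S SE [A [_ sSA cA]]] := lazy_burning_edges lB le_tV.
have /andP[sSE /eqP cS] := SE.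
have lamS : {in S &, forall h h', h != h' -> (#|h :&: h'| <= lam)%N}.
  by move=> h h' hS h'S; apply: hlam; apply: (subsetP sSE).
have leD : (D_min E t <= \sum_(h in S) #|h|)%N.
  by rewrite /D_min; apply: bigminn_le_cond.
(* Moving the subtracted terms to the right turns the integer inequality into one between natural
   numbers. *)
rewrite !lerBlDr -PoszM -!PoszD lez_nat.
apply: leq_trans leD (leq_trans (sum_card_le_cover lamS) _).
by rewrite cS leq_add2r -cB -cA subset_leq_card.
Qed.
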